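(* Let $\Omega$ be a finite state space, let $P=[p(u,v)]_{u,v\in\Omega}$ be an irreducible transition matrix on $\Omega$ with invariant distribution $\mu$, and let $\{u_k\}_{k\ge 1}$ be a Markov chain generated by $P$ with initial distribution $\nu$ (i.e. $u_1\sim\nu$). For $n\in\mathbb{N}_+$ and $u,v\in\Omega$ set $r_n(u,v)=\frac1n\sum_{k=1}^n \mathbb{1}[(u_k,u_{k+1})=(u,v)]$. Then there exist absolute constants $C_1,C_2>0$ (independent of $\Omega,P,\nu,n,t,u,v$) such that for every $n\in\mathbb{N}_+$, every $t>0$ and all $u,v\in\Omega$, $$\mathbb{P}\left\{|r_n(u,v)-\mu(u)p(u,v)|\ge t\right\}\le C_1\|\nu/\mu\|_\infty\exp\left(-C_2\,\eta_p(P)\,n\,t^2\right),$$ where $\eta_p(P)$ is the iterated Poincaré gap of $P$.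
   Context: $|\Omega|\ge 2$. Functions on $\Omega$ are acted on by $P$ via $Ph(u)=\sum_{v}p(u,v)h(v)$. The invariant distribution $\mu$ satisfies $\sum_u\mu(u)p(u,v)=\mu(v)$ for all $v$; by irreducibility it is unique and strictly positive. $L_{2,\mu}$ is the space of real functions on $\Omega$ with inner product $\langle f,g\rangle_\mu=\sum_u\mu(u)f(u)g(u)$ and norm $\|\cdot\|_\mu$, and $L_{2,\mu}^0=\{h:\sum_u\mu(u)h(u)=0\}$. The iterated Poincaré gap (IP gap) is $\eta_p(P)=\inf_{0\ne h\in L^0_{2,\mu}}\|(I-P)h\|_\mu/\|h\|_\mu$. $\|\nu/\mu\|_\infty=\max_{u\in\Omega}\nu(u)/\mu(u)$. *)

(* Defs.v *)
From HB Require Import structures.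
From mathcomp Require Import all_boot all_order all_algebra.
From mathcomp Require Import all_classical all_reals all_analysis.

Set Implicit Arguments.
Unset Strict Implicit.
Unset Printing Implicit Defensive.

Import Order.TTheory GRing.Theory Num.Theory.

Local Open Scope classical_set_scope.
Local Open Scope ring_scope.

Definition is_distribution (R : realType) (Omega : finType) (mu : Omega -> R) : Prop :=
  (forall u, 0 <= mu u) /\ \sum_u mu u = 1.

Definition is_transition (R : realType) (Omega : finType)
    (p : Omega -> Omega -> R) : Prop :=
  forall u, is_distribution (p u).

(* Entry (u, v) of the n-th power of the transition matrix. *)
Fixpoint nstep (R : realType) (Omega : finType) (p : Omega -> Omega -> R)
    (n : nat) (u v : Omega) : R :=
  match n with
  | 0 => (u == v)%:R
  | m.+1 => \sum_w p u w * nstep p m w v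
  end.

Definition irreducible (R : realType) (Omega : finType)
    (p : Omega -> Omega -> R) : Prop :=
  forall u v, exists n, 0 < nstep p n u v.

Definition invariant_dist (R : realType) (Omega : finType)
    (p : Omega -> Omega -> R) (mu : Omega -> R) : Prop :=
  is_distribution mu /\ forall v, \sum_u mu u * p u v = mu v.

Definition transition_op (R : realType) (Omega : finType)
    (p : Omega -> Omega -> R) (h : {ffun Omega -> R}) : {ffun Omega -> R} :=
  [ffun u => \sum_v p u v * h v].

Definition dot_mu (R : realType) (Omega : finType) (mu : Omega -> R)
    (f g : {ffun Omega -> R}) : R :=
  \sum_u mu u * f u * g u.

Definition norm_mu (R : realType) (Omega : finType) (mu : Omega -> R)
    (f : {ffun Omega -> R}) : R :=
  Num.sqrt (dot_mu mu f f).

Definition L20 (R : realType) (Omega : finType) (mu : Omega -> R) :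
    set {ffun Omega -> R} :=
  [set h | \sum_u mu u * h u = 0].

(* [inf] is 0 on the empty set, which only arises when #|Omega| <= 1. *)
Definition ip_gap (R : realType) (Omega : finType)
    (p : Omega -> Omega -> R) (mu : Omega -> R) : R :=
  inf [set norm_mu mu (h - transition_op p h) / norm_mu mu h
      | h in [set h | h != 0 /\ L20 mu h]].

(* The default value 0 is harmless since the ratios are nonnegative. *)
Definition ratio_sup (R : realType) (Omega : finType) (nu mu : Omega -> R) : R :=
  \big[Num.max/0]_(u : Omega) (nu u / mu u).

(* Time is indexed from 0, so that [X k] stands for u_(k+1). The Markov
   property is written without division, so that histories of probability
   zero need no separate treatment. *)
Definition markov_chain (R : realType) (d : measure_display)
    (T : measurableType d) (Pr : probability T R) (Omega : finType)
    (p : Omega -> Omega -> R) (nu : Omega -> R) (X : nat -> T -> Omega) : Prop :=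
  [/\ forall k (A : set Omega), measurable (X k @^-1` A),
      forall u, Pr [set w | X 0%N w = u] = (nu u)%:E
    & forall (k : nat) (x : nat -> Omega),
        Pr [set w | forall i, (i <= k.+1)%N -> X i w = x i] =
        (Pr [set w | forall i, (i <= k)%N -> X i w = x i]
           * (p (x k) (x k.+1))%:E)%E].

Definition pair_freq (R : realType) (T : Type) (Omega : finType)
    (X : nat -> T -> Omega) (n : nat) (u v : Omega) (w : T) : R :=
  n%:R^-1 * \sum_(k < n) ((X k w, X k.+1 w) == (u, v))%:R.

(* Main.v *)
(** Let [f] be the centred indicator of the pair [(u, v)]. In place of the
    moment generating function of the partial sum [S_n] at a fixed time, consider its
    discounted sum over all times, whose value at a starting state [x] is a
    solution [h] of [h = 1 + z P_theta h], where [P_theta(x, y) =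
    p(x, y) exp (theta f(x, y))] and [1 - z] is of order [theta^2 / eta + 1 / n].
    Splitting [h] into its [mu]-mean and a centred part [g], the IP gap gives
    [|g| <= C theta / eta * mu(h)], because [z P] inherits the gap:
    [|g - z P g| >= z |g - P g|], as [<g - P g, g> >= 0]. Substituting this into
    the equation for [mu(h)] gives [mu(h) <= 4 n], i.e. the moment generating
    functions of [S_0, ..., S_n] are bounded by [C exp (C theta^2 n / eta)] on
    average over time. Since [S_n] is the sum of [S_m] and a copy of [S_(n-m)]
    started from the stationary law, the average over [m] suffices to control
    [E exp (theta S_n / 2)], and Chernoff's bound concludes. *)
Require Import Defs.
From HB Require Import structures.
From mathcomp Require Import all_boot all_order all_algebra.
From mathcomp Require Import all_classical all_reals all_analysis.
From mathcomp Require Import ring lra.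

Import Order.TTheory GRing.Theory Num.Theory.

Set Implicit Arguments.
Unset Strict Implicit.
Unset Printing Implicit Defensive.

Local Open Scope classical_set_scope.
Local Open Scope ring_scope.

(** * Averages over a finite state space *)

Section FiniteMean.
Context {R : realType} {Omega : finType}.
Implicit Types (q f g : Omega -> R) (k : Omega -> Omega -> R).

(** [q] is any real weight, so the same sum serves for distributions, for rows of tilted kernels and
    for signed differences of kernels. *)
Definition mean q f : R := \sum_u q u * f u.

Definition kact k f (x : Omega) : R := mean (k x) f.

Lemma meanD q f g : mean q (fun x => f x + g x) = mean q f + mean q g.
Proof. by rewrite -big_split; apply: eq_bigr => x _; rewrite mulrDr. Qed.

Lemma meanZ q c f : mean q (fun x => c * f x) = c * mean q f.
Proof. by rewrite mulr_sumr; apply: eq_bigr => x _; rewrite mulrCA. Qed.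

Lemma meanB q f g : mean q (fun x => f x - g x) = mean q f - mean q g.
Proof. by rewrite -sumrB; apply: eq_bigr => x _; rewrite mulrBr. Qed.

Lemma eq_mean q f g : f =1 g -> mean q f = mean q g.
Proof. by move=> fg; apply: eq_bigr => x _; rewrite fg. Qed.

Lemma mean_cst q c : is_distribution q -> mean q (fun=> c) = c.
Proof. by case=> _ q1; rewrite /mean -mulr_suml q1 mul1r. Qed.

Lemma le_mean q f g : (forall x, 0 <= q x) -> (forall x, f x <= g x) ->
  mean q f <= mean q g.
Proof. by move=> q0 fg; apply: ler_sum => x _; rewrite ler_wpM2l. Qed.

Lemma mean_ge0 q f : (forall x, 0 <= q x) -> (forall x, 0 <= f x) ->
  0 <= mean q f.
Proof. by move=> q0 f0; apply: sumr_ge0 => x _; rewrite mulr_ge0. Qed.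

Lemma sqr_mean_le q f : is_distribution q ->
  mean q f ^+ 2 <= mean q (fun x => f x ^+ 2).
Proof.
move=> dq; rewrite -subr_ge0; set m := mean q f.
suff -> : mean q (fun x => f x ^+ 2) - m ^+ 2 =
          mean q (fun x => (f x - m) ^+ 2).
  by apply: mean_ge0 => [x|x]; [exact: dq.1|exact: sqr_ge0].
rewrite (@eq_mean q (fun x => (f x - m) ^+ 2) (fun x => (f x ^+ 2 - (2 * m) * f x) + m ^+ 2)).
  by rewrite meanD meanB meanZ mean_cst// -/m; ring.
by move=> x; ring.
Qed.

Lemma mean_indic q a : mean q (fun x => (x == a)%:R) = q a.
Proof.
rewrite /mean (bigD1 a)//= eqxx mulr1 big1 ?addr0// => x /negPf ->.
by rewrite mulr0.
Qed.

Lemma mean_kact q k f :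
  mean q (kact k f) = \sum_y (\sum_x q x * k x y) * f y.
Proof.
rewrite /mean /kact /mean.
under eq_bigr do rewrite mulr_sumr.
rewrite exchange_big; apply: eq_bigr => y _ /=.
by rewrite mulr_suml; apply: eq_bigr => x _; rewrite mulrA.
Qed.

End FiniteMean.

(** * The resolvent equation of a perturbed kernel under the IP gap *)

Section Resolvent.
Context {R : realType} {Omega : finType}.
Variables (p : Omega -> Omega -> R) (mu : Omega -> R).
Hypotheses (ptrans : is_transition p) (muinv : invariant_dist p mu).
Implicit Types (f g h : Omega -> R).

Let p_ge0 x y : 0 <= p x y. Proof. exact: (ptrans x).1. Qed.
Let mu_ge0 x : 0 <= mu x. Proof. exact: muinv.1.1. Qed.

Lemma mean_inv f : mean mu (kact p f) = mean mu f.
Proof. by rewrite mean_kact; apply: eq_bigr => y _; rewrite muinv.2. Qed.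

(** Some state carries mass, and invariance under every power of [p] passes a positive share of it
    to any state reachable from there. *)
Lemma inv_pos : irreducible p -> forall x, 0 < mu x.
Proof.
move=> irr y.
have ns_ge0 n u v : 0 <= nstep p n u v.
  elim: n u => [|n IH] u /=; first exact: ler0n.
  by apply: sumr_ge0 => w _; rewrite mulr_ge0.
have ns_inv n v : \sum_u mu u * nstep p n u v = mu v.
  elim: n => [|n IH] /=; first exact: mean_indic.
  by rewrite -[RHS]IH -[RHS](mean_inv (fun u => nstep p n u v)).
have [x x0] : exists x, 0 < mu x.
  apply/not_existsP => mu0; have := muinv.1.2; rewrite big1 => [/esym/eqP|x _].
    by rewrite oner_eq0.
  by apply/eqP; rewrite eq_le mu_ge0 andbT leNgt; apply/negP/mu0.
have [n xy] := irr x y.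
rewrite -(ns_inv n y) (bigD1 x)//=; apply: ltr_pwDl; first exact: mulr_gt0.
by apply: sumr_ge0 => w _; rewrite mulr_ge0.
Qed.

Lemma mean_sqr_kact_le f :
  mean mu (fun x => kact p f x ^+ 2) <= mean mu (fun x => f x ^+ 2).
Proof.
rewrite -(mean_inv (fun x => f x ^+ 2)).
by apply: le_mean => // x; apply: sqr_mean_le.
Qed.

(** Twice this form equals [|f - P f|^2 + |f|^2 - |P f|^2], and [P] contracts the norm by Jensen and
    invariance. *)
Lemma dirichlet_ge0 f : 0 <= mean mu (fun x => (f x - kact p f x) * f x).
Proof.
have : 0 <= mean mu (fun x => (f x - kact p f x) ^+ 2).
  by apply: mean_ge0 => // x; exact: sqr_ge0.
have := mean_sqr_kact_le f.
set a := mean mu (fun x => kact p f x ^+ 2); set b := mean mu (fun x => f x ^+ 2).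
rewrite (@eq_mean _ _ mu _
  (fun x => 2 * ((f x - kact p f x) * f x) - f x ^+ 2 + kact p f x ^+ 2)).
  by rewrite meanD meanB meanZ -/a -/b; lra.
by move=> x; ring.
Qed.

Let dotE (f : {ffun Omega -> R}) : dot_mu mu f f = mean mu (fun x => f x ^+ 2).
Proof. by apply: eq_bigr => x _; ring. Qed.

Let IPE (f : {ffun Omega -> R}) :
  f - transition_op p f = [ffun x => f x - kact p f x].
Proof. by apply/ffunP => x; rewrite !ffunE. Qed.

Hypothesis mu_gt0 : forall x, 0 < mu x.

Lemma mean_sqr_eq0 f : mean mu (fun x => f x ^+ 2) <= 0 -> forall x, f x = 0.
Proof.
move=> f0 x; apply/eqP; rewrite -(sqrf_eq0 (f x)).
have /eqP : mean mu (fun x => f x ^+ 2) = 0.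
  apply/eqP; rewrite eq_le f0 /=.
  by apply: mean_ge0 => // y; exact: sqr_ge0.
rewrite psumr_eq0 => [/allP/(_ x (mem_index_enum _))|y _]; last first.
  by rewrite mulr_ge0 ?sqr_ge0.
by rewrite mulf_eq0 gt_eqF//=.
Qed.

Lemma norm_mu_gt0 (f : {ffun Omega -> R}) : f != 0 -> 0 < norm_mu mu f.
Proof.
move=> f0; rewrite sqrtr_gt0 dotE ltNge; apply: contra f0 => f0.
by apply/eqP/ffunP => x; rewrite ffunE; exact: mean_sqr_eq0.
Qed.

Let gap_lbound : lbound [set norm_mu mu (h - transition_op p h) / norm_mu mu h
      | h in [set h | h != 0 /\ L20 mu h]] 0.
Proof. by move=> _ [h _ <-]; rewrite divr_ge0 ?sqrtr_ge0. Qed.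

Lemma ip_gap_ge0 : 0 <= ip_gap p mu.
Proof.
rewrite /ip_gap; set S := image _ _.
have [->|/set0P ne] := eqVneq S set0; first by rewrite inf0.
exact: lb_le_inf.
Qed.

(** Squaring and clearing the quotient removes the root and includes [f = 0]. *)
Lemma ip_gap_sqr_le f : mean mu f = 0 ->
  ip_gap p mu ^+ 2 * mean mu (fun x => f x ^+ 2) <=
  mean mu (fun x => (f x - kact p f x) ^+ 2).
Proof.
move=> f0; have [h hf] : exists h : {ffun Omega -> R}, h =1 f.
  by exists (finfun f) => x; rewrite ffunE.
have -> : mean mu (fun x => f x ^+ 2) = mean mu (fun x => h x ^+ 2).
  by apply: eq_mean => x; rewrite hf.
have -> : mean mu (fun x => (f x - kact p f x) ^+ 2) =
          mean mu (fun x => [ffun x => h x - kact p h x] x ^+ 2).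
  by apply: eq_mean => x; rewrite ffunE hf /kact (eq_mean _ hf).
rewrite -IPE -!dotE.
have [->|h0] := eqVneq h 0.
  have -> : dot_mu mu (0 : {ffun Omega -> R}) 0 = 0.
    by apply: big1 => x _; rewrite ffunE mulr0.
  rewrite mulr0 dotE.
  by apply: mean_ge0 => // x; exact: sqr_ge0.
have hpos := norm_mu_gt0 h0.
have dot_ge0 (g : {ffun Omega -> R}) : 0 <= dot_mu mu g g.
  by rewrite dotE; apply: mean_ge0 => // x; exact: sqr_ge0.
have gh : ip_gap p mu * norm_mu mu h <= norm_mu mu (h - transition_op p h).
  rewrite -ler_pdivlMr//; apply: ge_inf; first by exists 0.
  exists h => //; split=> //; rewrite /L20 /=.
  by rewrite -[RHS]f0; apply: eq_mean.
rewrite -(sqr_sqrtr (dot_ge0 h)) -(sqr_sqrtr (dot_ge0 (_ - _))) -exprMn.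
by rewrite ler_pXn2r ?nnegrE ?mulr_ge0 ?sqrtr_ge0 ?ip_gap_ge0.
Qed.

(** Contractivity gives [|h - P h| <= 2 |h|]; two distinct states supply a nonzero centred [h] to
    test with. *)
Lemma ip_gap_le2 : (1 < #|Omega|)%N -> ip_gap p mu <= 2.
Proof.
move=> /card_gt1P[a [b [_ _ ab]]].
pose h := [ffun x => (x == a)%:R / mu a - (x == b)%:R / mu b : R].
have h0 : mean mu h = 0.
  rewrite (@eq_mean _ _ mu _
    (fun x => (mu a)^-1 * (x == a)%:R - (mu b)^-1 * (x == b)%:R)); last first.
    by move=> x; rewrite ffunE; ring.
  by rewrite meanB !meanZ !mean_indic !mulVf ?gt_eqF// subrr.
have hn0 : h != 0.
  apply/eqP => /ffunP /(_ a); rewrite !ffunE eqxx (negPf ab) mul0r subr0 => /eqP.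
  by rewrite mulf_eq0 oner_eq0 invr_eq0 gt_eqF.
have sq0 f : 0 <= mean mu (fun x => f x ^+ 2).
  by apply: mean_ge0 => // x; exact: sqr_ge0.
rewrite -(ler_pXn2r (n := 2))// ?nnegrE ?ip_gap_ge0//.
have hpos : 0 < mean mu (fun x => h x ^+ 2).
  by rewrite -dotE -sqrtr_gt0; exact: norm_mu_gt0.
rewrite -(ler_pM2r hpos); apply: le_trans (ip_gap_sqr_le h0) _.
have := mean_sqr_kact_le h; have := sq0 (fun x => h x + kact p h x).
set A := mean mu (fun x => h x ^+ 2); set B := mean mu (fun x => kact p h x ^+ 2).
rewrite (@eq_mean _ _ mu _
  (fun x => 2 * h x ^+ 2 + 2 * kact p h x ^+ 2 - (h x - kact p h x) ^+ 2)).
  by rewrite meanB meanD !meanZ -/A -/B; lra.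
by move=> x; ring.
Qed.

(** For the tilted kernel [delta] is of order theta but [eps] only of order theta^2, since centring
    cancels the first-order term in the averaged row sums. *)
Variables (k : Omega -> Omega -> R) (delta eps : R).
Hypothesis k_close : forall x y, `|k x y - p x y| <= delta * p x y.
Hypothesis k_mean : `|mean mu (fun x => \sum_y (k x y - p x y))| <= eps.
Hypothesis delta_ge0 : 0 <= delta.

Let d x y := k x y - p x y.

(** Pointwise [|d f| <= delta * P |f|]; Jensen and invariance do the rest. *)
Lemma mean_sqr_pert_le f :
  mean mu (fun x => kact d f x ^+ 2) <=
  delta ^+ 2 * mean mu (fun x => f x ^+ 2).
Proof.
rewrite -(mean_inv (fun x => f x ^+ 2)) -meanZ.
apply: le_mean => // x.
apply: (@le_trans _ _ ((delta * kact p (fun y => `|f y|) x) ^+ 2)).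
  rewrite -real_normK ?num_real// ler_pXn2r ?nnegrE ?normr_ge0//; last first.
    by rewrite mulr_ge0// mean_ge0.
  rewrite /kact /mean mulr_sumr; apply: le_trans (ler_norm_sum _ _ _) _.
  by apply: ler_sum => y _; rewrite normrM mulrA ler_wpM2r// k_close.
rewrite exprMn ler_wpM2l ?sqr_ge0//.
apply: le_trans (sqr_mean_le _ (ptrans x)) _.
by rewrite /kact (@eq_mean _ _ _ _ (fun y => f y ^+ 2))// => y; rewrite real_normK ?num_real.
Qed.

(** The perturbation turns the mean of [h] into a centred part of relative size [delta / eta], and
    acting once more it feeds this back into the mean, whence [delta^2 / eta]. The case [b = 0]
    yields uniqueness, [b = 1] the size of the solution. *)
Lemma resolvent_bound (b z : R) h :
  0 < ip_gap p mu -> 2 * delta <= ip_gap p mu -> 0 <= z <= 1 ->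
  (forall x, h x = b + z * kact k h x) ->
  (1 - z - eps - 2 * delta ^+ 2 / ip_gap p mu) * `|mean mu h| <= `|b| /\
  mean mu (fun x => h x ^+ 2) <= 2 * mean mu h ^+ 2.
Proof.
set eta := ip_gap p mu => eta0 deta /andP[z0 z1] hE.
have dmu := muinv.1.
set c := mean mu h; pose g x := h x - c.
have mg : mean mu g = 0 by rewrite /g meanB mean_cst// subrr.
have kE f x : kact k f x = kact p f x + kact d f x.
  rewrite /kact /mean -big_split; apply: eq_bigr => y _ /=.
  by rewrite /d -mulrDl addrCA subrr addr0.
set G := mean mu (fun x => g x ^+ 2).
have G0 : 0 <= G by apply: mean_ge0 => // x; exact: sqr_ge0.
have hG : mean mu (fun x => h x ^+ 2) = c ^+ 2 + G.
  rewrite (@eq_mean _ _ mu _ (fun x => g x ^+ 2 + (2 * c) * g x + c ^+ 2)).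
    by rewrite !meanD !meanZ mg mean_cst// -/G; ring.
  by move=> x; rewrite /g; ring.
set m := mean mu (kact d h).
(* The averaged equation; subtracting it from the pointwise one leaves an equation for [g]. *)
have cE : (1 - z) * c = b + z * m.
  have : c = b + z * (c + m).
    rewrite {1}/c (eq_mean mu hE) meanD mean_cst// meanZ.
    by rewrite (eq_mean mu (kE h)) meanD mean_inv.
  by move=> E; rewrite mulrBl mul1r {1}E; ring.
have gE x : g x - z * kact p g x = z * (kact d h x - m).
  have pg : kact p g x = kact p h x - c by rewrite /kact /g meanB mean_cst.
  rewrite pg /g hE kE; move: cE => /eqP; rewrite -subr_eq0 => /eqP cE0.
  by apply/eqP; rewrite -subr_eq0 -[X in _ == X]oppr0 -cE0; apply/eqP; ring.
(* Below: [g - z P g = z (g - P g) + (1 - z) g], whose cross term is nonnegative by [dirichlet_ge0].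
   Above: removing the mean [m] can only shrink the norm of [d h]. *)
have G1 : z ^+ 2 * (eta ^+ 2 * G) <= z ^+ 2 * (delta ^+ 2 * (c ^+ 2 + G)).
  apply: (@le_trans _ _ (mean mu (fun x => (g x - z * kact p g x) ^+ 2))).
    rewrite (@eq_mean _ _ mu _ (fun x => z ^+ 2 * (g x - kact p g x) ^+ 2 +
      2 * z * (1 - z) * ((g x - kact p g x) * g x) + (1 - z) ^+ 2 * g x ^+ 2)).
      rewrite !meanD !meanZ -/G.
      have A := ip_gap_sqr_le mg; rewrite -/eta -/G in A.
      have B : 0 <= 2 * z * (1 - z) * mean mu (fun x => (g x - kact p g x) * g x).
        by rewrite !mulr_ge0 ?dirichlet_ge0// subr_ge0.
      have C : 0 <= (1 - z) ^+ 2 * G by rewrite mulr_ge0// sqr_ge0.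
      rewrite -addrA -[X in X <= _]addr0 lerD// ?addr_ge0//.
      by rewrite ler_wpM2l// sqr_ge0.
    by move=> x; ring.
  rewrite (eq_mean mu (g := fun x => z ^+ 2 * (kact d h x - m) ^+ 2)).
    rewrite meanZ ler_wpM2l ?sqr_ge0//.
    rewrite -hG; apply: le_trans (mean_sqr_pert_le h).
    rewrite (@eq_mean _ _ mu (fun x => (_ - m) ^+ 2)
      (fun x => kact d h x ^+ 2 - (2 * m) * kact d h x + m ^+ 2)).
      by rewrite meanD meanB meanZ mean_cst// -/m; have := sqr_ge0 m; lra.
    by move=> x; ring.
  by move=> x; rewrite gE exprMn.
(* The factor [z^2] cancels; at [z = 0] the centred part vanishes. *)
have G2 : eta ^+ 2 * G <= delta ^+ 2 * (c ^+ 2 + G).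
  have [zz|zn] := eqVneq z 0; last first.
    by rewrite -(@ler_pM2l _ (z ^+ 2))// exprn_even_gt0.
  have -> : G = 0.
    rewrite /G (@eq_mean _ _ mu _ (fun=> 0)) ?mean_cst// => x.
    by have := gE x; rewrite zz !mul0r subr0 => ->; rewrite expr0n.
  by rewrite mulr0 addr0 mulr_ge0 ?sqr_ge0.
have dd : 4 * delta ^+ 2 <= eta ^+ 2.
  have -> : 4 * delta ^+ 2 = (2 * delta) ^+ 2 by ring.
  by rewrite ler_pXn2r ?nnegrE// ?mulr_ge0// ltW.
have e2 : 0 < eta ^+ 2 by rewrite exprn_gt0.
(* Since [2 * delta <= eta], the term [delta^2 G] is absorbed on the left. *)
have G3 : 3 * (eta ^+ 2 * G) <= 4 * (delta ^+ 2 * c ^+ 2).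
  have : 4 * delta ^+ 2 * G <= eta ^+ 2 * G by rewrite ler_wpM2r.
  by move: G2; rewrite mulrDr; lra.
split; last first.
  have : 4 * delta ^+ 2 * c ^+ 2 <= eta ^+ 2 * c ^+ 2.
    by rewrite ler_wpM2r// sqr_ge0.
  rewrite hG => B; suff : G <= c ^+ 2 by lra.
  rewrite -(ler_pM2l e2).
  have : 0 <= eta ^+ 2 * c ^+ 2 by rewrite mulr_ge0 ?sqr_ge0.
  by lra.
set w := mean mu (kact d g).
have wle : `|w| <= 2 * delta ^+ 2 / eta * `|c|.
  rewrite -(ler_pXn2r (n := 2))// ?nnegrE ?normr_ge0 ?mulr_ge0 ?sqr_ge0 ?invr_ge0 ?(ltW eta0)//.
  rewrite real_normK ?num_real//; apply: le_trans (sqr_mean_le (kact d g) dmu) _.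
  apply: le_trans (mean_sqr_pert_le g) _; rewrite -/G.
  rewrite exprMn real_normK ?num_real// expr_div_n [X in _ <= X]mulrAC ler_pdivlMr//.
  have -> : (2 * delta ^+ 2) ^+ 2 * c ^+ 2 = delta ^+ 2 * (4 * (delta ^+ 2 * c ^+ 2)) by ring.
  rewrite -mulrA ler_wpM2l ?sqr_ge0// mulrC.
  have : 0 <= eta ^+ 2 * G by rewrite mulr_ge0 ?sqr_ge0.
  by lra.
(* Splitting [h = c + g]: the constant meets only the averaged row sums, which [eps] controls. *)
have mE : m = c * mean mu (fun x => \sum_y (k x y - p x y)) + w.
  rewrite -meanZ -meanD; apply: eq_mean => x.
  rewrite /kact /mean mulr_sumr -big_split; apply: eq_bigr => y _ /=.
  by rewrite /g /d; ring.
have mle : `|m| <= eps * `|c| + 2 * delta ^+ 2 / eta * `|c|.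
  rewrite mE (le_trans (ler_normD _ _))// lerD// normrM mulrC.
  by rewrite ler_wpM2r.
have bE : (1 - z) * `|c| <= `|b| + `|m|.
  have -> : (1 - z) * `|c| = `|(1 - z) * c| by rewrite normrM (ger0_norm (x := 1 - z)) ?subr_ge0.
  rewrite cE (le_trans (ler_normD _ _))// lerD2l// normrM.
  by rewrite -[X in _ <= X]mul1r ler_wpM2r// ger0_norm.
by rewrite !mulrBl in bE *; lra.
Qed.

End Resolvent.

(** * Nonnegative solutions of the resolvent equation and the Neumann series *)

Section Neumann.
Context {R : realType} {Omega : finType}.
Variable k : Omega -> Omega -> R.
Hypothesis k_ge0 : forall x y, 0 <= k x y.
Implicit Types (f g h : {ffun Omega -> R^o}) (z : R).

(** The total weight of the paths of length [m] from a state; for the tilted kernel, the moment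
    generating function of the partial sum. *)
Definition kpow (m : nat) : Omega -> R := iter m (kact k) (fun=> 1).

Definition resolvent_op z h : {ffun Omega -> R^o} :=
  [ffun x => h x - z * kact k h x].

Fact resolvent_op_is_linear z : linear (resolvent_op z).
Proof.
move=> a f g; apply/ffunP => x; rewrite !ffunE.
have -> : kact k (a *: f + g : {ffun Omega -> R^o}) x = a * kact k f x + kact k g x.
  by rewrite /kact -meanZ -meanD; apply: eq_mean => y; rewrite !ffunE.
by rewrite /GRing.scale /=; ring.
Qed.

HB.instance Definition _ z :=
  GRing.isLinear.Build R {ffun Omega -> R^o} {ffun Omega -> R^o} *:%R
    (resolvent_op z) (resolvent_op_is_linear z).

(** An injective endomorphism of a finite-dimensional space is onto, so no convergence of the series
    is involved. *)
Lemma resolvent_surj z :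
  (forall h, (forall x, h x = z * kact k h x) -> h = 0) ->
  exists h, forall x, h x = 1 + z * kact k h x.
Proof.
move=> inj; pose F : 'End({ffun Omega -> R^o}) := linfun (resolvent_op z).
have kerF : lker F == 0%VS.
  apply/lker0P => f g; rewrite !lfunE /= => /eqP.
  rewrite -subr_eq0 -linearB /= => /eqP/ffunP fg0.
  apply/eqP; rewrite -subr_eq0; apply/eqP/inj => x.
  by have := fg0 x; rewrite ffunE [RHS]ffunE => /eqP; rewrite subr_eq0 => /eqP.
have : ([ffun=> 1] : {ffun Omega -> R^o}) \in limg F by rewrite lker0_limgf// memvf.
move=> /memv_imgP[h _]; rewrite lfunE /= => /ffunP hE.
by exists h => x; have := hE x; rewrite !ffunE => ->; rewrite subrK.
Qed.

(** Minimum principle for [h / f]: at a minimiser [u] with negative ratio the equation would give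
    [h u >= 1 + h u]. *)
Lemma supersolution_ge0 z h f : 0 <= z ->
  (forall x, 1 <= f x) -> (forall x, z * kact k f x <= f x) ->
  (forall x, h x = 1 + z * kact k h x) -> forall x, 0 <= h x.
Proof.
move=> z0 f1 kf hE x0.
have fpos x : 0 < f x by exact: lt_le_trans (f1 x).
have [u _ umin] := @Order.TotalTheory.arg_minP _ _ _ x0 xpredT
  (fun x => h x / f x) isT.
set m := h u / f u in umin.
have hm x : m * f x <= h x by rewrite -ler_pdivlMr// umin.
have hu : h u = m * f u by rewrite divfK// gt_eqF.
suff m0 : 0 <= m by apply: le_trans (hm x0); rewrite mulr_ge0// ltW.
rewrite leNgt; apply/negP => m0.
have : 1 + m * f u <= h u.
  rewrite hE lerD2l; apply: (@le_trans _ _ (m * (z * kact k f u))).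
    by rewrite ler_wnM2l// ltW.
  rewrite mulrCA ler_wpM2l// /kact -meanZ; exact: le_mean.
by rewrite hu gerDr ler10.
Qed.

(* Without an a priori bound the nonnegativity of the solution may fail (for
   [z] beyond the inverse of the spectral radius); with it, nonnegativity
   propagates from [z = 0] by steps of a uniform length. *)
Lemma neumann_bound (z0 B : R) : 0 <= z0 ->
  (forall z h, 0 <= z <= z0 -> (forall x, h x = z * kact k h x) -> h = 0) ->
  (forall z h, 0 <= z <= z0 -> (forall x, 0 <= h x) ->
    (forall x, h x = 1 + z * kact k h x) -> forall x, h x <= B) ->
  exists h, [/\ forall x, 0 <= h x, forall x, h x = 1 + z0 * kact k h x &
    forall n x, \sum_(m < n) z0 ^+ m * kpow m x <= h x].
Proof.
move=> z00 inj bnd.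
pose M := \sum_x \sum_y k x y.
have M0 : 0 <= M by apply: sumr_ge0 => x _; exact: sumr_ge0.
have sumM x : \sum_y k x y <= M.
  by rewrite /M [X in _ <= X](bigD1 x)//= lerDl; apply: sumr_ge0 => y _; exact: sumr_ge0.
(* Chosen so that [s * k f <= 1] whenever [0 <= f <= B]; the added 1 keeps the divisor positive. *)
pose s := (M * `|B| + 1)^-1.
have s0 : 0 < s by rewrite invr_gt0 ltr_wpDl// mulr_ge0.
have sol z : 0 <= z <= z0 -> exists h, forall x, h x = 1 + z * kact k h x.
  by move=> zz; apply: resolvent_surj => h; exact: inj.
have ge0 j z h : 0 <= z <= z0 -> z <= j%:R * s ->
    (forall x, h x = 1 + z * kact k h x) -> forall x, 0 <= h x.
  elim: j z h => [|j IH] z h /andP[zge0 zle] zj hE.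
    move=> x; rewrite hE; have -> : z = 0 by apply/eqP; rewrite eq_le zge0 (le_trans zj)// mul0r.
    by rewrite mul0r addr0.
  (* The solution [f] at the previous point [y] is a supersolution at [z], because [f = 1 + y * k f]
     and [(z - y) * k f <= 1]. *)
  pose y := Num.max 0 (z - s).
  have y0 : 0 <= y by rewrite le_max lexx.
  have yz : y <= z by rewrite ge_max zge0 gerBl ltW.
  have zy : z - y <= s by rewrite lerBlDr addrC -lerBlDr le_max lexx orbT.
  have yz0 : 0 <= y <= z0 by rewrite y0 (le_trans yz).
  have [f fE] := sol y yz0.
  have f0 : forall x, 0 <= f x.
    apply: (IH y) => //; rewrite ge_max mulr_ge0 ?(ltW s0)//=.
    by rewrite lerBlDr; move: zj; rewrite -natr1 mulrDl mul1r.
  have fB := bnd y f yz0 f0 fE.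
  have kf0 x : 0 <= kact k f x by exact: mean_ge0.
  apply: (@supersolution_ge0 z h f) => // x.
    by rewrite fE lerDl mulr_ge0.
  have kfB : kact k f x <= M * `|B|.
    apply: (@le_trans _ _ (\sum_y k x y * `|B|)).
      by apply: ler_sum => w _; rewrite ler_wpM2l// (le_trans (fB w))// ler_norm.
    by rewrite -mulr_suml ler_wpM2r.
  have : (z - y) * kact k f x <= 1.
    apply: (@le_trans _ _ (s * (M * `|B|))).
      by apply: ler_pM => //; rewrite subr_ge0.
    rewrite mulrC ler_pdivrMr ?mul1r ?lerDl// ltr_wpDl// mulr_ge0//.
  by rewrite [X in _ -> _ <= X]fE mulrBl; lra.
have [h hE] := sol z0 (introT andP (conj z00 (lexx z0))).
have h0 : forall x, 0 <= h x.
  apply: (ge0 (Num.bound (z0 / s)) z0) => //; first by rewrite z00 lexx.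
  by rewrite -ler_pdivrMr// ltW// archi_boundP// divr_ge0// ltW.
(* Iterating the equation from [h >= 0] places every partial sum of the series below [h]. *)
exists h; split=> //; elim=> [|n IH] x; first by rewrite big_ord0.
rewrite big_ord_recl expr0 mul1r hE lerD2l.
apply: (@le_trans _ _ (z0 * kact k (fun y => \sum_(m < n) z0 ^+ m * kpow m y) x)).
  rewrite le_eqVlt; apply/orP; left; apply/eqP.
  rewrite /kact /mean; under [in RHS]eq_bigr do rewrite mulr_sumr.
  rewrite exchange_big mulr_sumr; apply: eq_bigr => m _ /=.
  rewrite exprS -mulrA; congr (_ * _); rewrite mulr_sumr.
  by apply: eq_bigr => y _; rewrite mulrCA.
by rewrite ler_wpM2l//; exact: le_mean.
Qed.

End Neumann.

(** * Exponential tilting of the transition matrix *)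

Section Tilt.
Context {R : realType} {Omega : finType}.
Variables (p : Omega -> Omega -> R) (mu : Omega -> R).
Hypotheses (ptrans : is_transition p) (muinv : invariant_dist p mu).
Hypothesis mu_gt0 : forall x, 0 < mu x.

(** [exp s <= 1 / (1 - s)], while [(1 + s + 2 s^2) (1 - s) = 1 + s^2 (1 - 2 s) >= 1]. *)
Lemma expR_le_quad (s : R) : s <= 2^-1 -> expR s <= 1 + s + 2 * s ^+ 2.
Proof.
move=> s1; have := expR_ge1Dx (- s); rewrite expRN => e1.
have e0 := expR_gt0 s; have s10 : 0 < 1 - s by lra.
have : expR s <= (1 - s)^-1 by rewrite -[expR s]invrK lef_pV2 ?posrE ?invr_gt0.
move=> /le_trans; apply; rewrite -div1r ler_pdivrMr//.
have : 0 <= s ^+ 2 * (1 - 2 * s) by rewrite mulr_ge0 ?sqr_ge0//; lra.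
suff -> : (1 + s + 2 * s ^+ 2) * (1 - s) = 1 + s ^+ 2 * (1 - 2 * s) by lra.
by ring.
Qed.

Lemma expR_sub1_le (s : R) : `|s| <= 2^-1 -> `|expR s - 1| <= 2 * `|s|.
Proof.
rewrite ler_norml => /andP[s1 s2].
have := expR_ge1Dx s; have := expR_le_quad s2.
rewrite ler_norml; case: (ger0P s) => s0 q l; apply/andP; split; try lra.
  have : s ^+ 2 <= s * 2^-1 by rewrite expr2 ler_wpM2l.
  by lra.
have : - s * - s <= - s * 2^-1 by rewrite ler_wpM2l//; lra.
by rewrite mulrNN -expr2; lra.
Qed.

Variables (F : Omega -> Omega -> R) (theta : R).

(** Left unnormalised, so that its powers carry the exponential weight of whole paths. *)
Definition tilt (x y : Omega) : R := p x y * expR (theta * F x y).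

Hypothesis F_le1 : forall x y, `|F x y| <= 1.
Hypothesis F_mean0 : mean mu (fun x => mean (p x) (F x)) = 0.
Hypothesis theta_gt0 : 0 < theta.
Hypothesis theta_le : 4 * theta <= ip_gap p mu.
Hypothesis gap_le2 : ip_gap p mu <= 2.

Let p_ge0 x y : 0 <= p x y. Proof. exact: (ptrans x).1. Qed.
Let mu_ge0 x : 0 <= mu x. Proof. exact: ltW. Qed.

Let theta_half : theta <= 2^-1.
Proof. by have := le_trans theta_le gap_le2; lra. Qed.

Let thetaF x y : `|theta * F x y| <= theta.
Proof. by rewrite normrM gtr0_norm// -[X in _ <= X]mulr1 ler_wpM2l// ltW. Qed.

Lemma tilt_close x y : `|tilt x y - p x y| <= 2 * theta * p x y.
Proof.
rewrite /tilt -[X in _ - X]mulr1 -mulrBr normrM ger0_norm// mulrC ler_wpM2r//.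
apply: le_trans (expR_sub1_le _) _.
  exact: le_trans (thetaF x y) theta_half.
by rewrite ler_wpM2l.
Qed.

(** The linear term [theta * F] averages to zero under the stationary law of pairs, so only the
    quadratic remainder is left. *)
Lemma tilt_mean_close :
  `|mean mu (fun x => \sum_y (tilt x y - p x y))| <= 2 * theta ^+ 2.
Proof.
have tE x : \sum_y (tilt x y - p x y) =
            mean (p x) (fun y => expR (theta * F x y) - 1).
  by apply: eq_bigr => y _; rewrite /tilt mulrBr mulr1.
rewrite (eq_mean mu tE).
have lb : mean mu (fun x => mean (p x) (fun y => theta * F x y)) = 0.
  by rewrite -[RHS](mulr0 theta) -F_mean0 -meanZ; apply: eq_mean => x; rewrite meanZ.
rewrite ger0_norm; last first.
  rewrite -lb; apply: le_mean => // x; apply: le_mean => // y.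
  by have := expR_ge1Dx (theta * F x y); lra.
apply: (@le_trans _ _ (mean mu (fun x => mean (p x)
  (fun y => theta * F x y + 2 * theta ^+ 2)))); last first.
  rewrite (eq_mean mu (g := fun x =>
    mean (p x) (fun y => theta * F x y) + 2 * theta ^+ 2)).
    by rewrite meanD lb mean_cst ?add0r//; exact: muinv.1.
  by move=> x; rewrite meanD mean_cst.
apply: le_mean => // x; apply: le_mean => // y.
have := thetaF x y; rewrite ler_norml => /andP[l1 l2].
have /expR_le_quad : theta * F x y <= 2^-1 by apply: le_trans l2 theta_half.
suff : (theta * F x y) ^+ 2 <= theta ^+ 2 by lra.
by rewrite -real_normK ?num_real// ler_pXn2r ?nnegrE// ltW.
Qed.

(* The resolvent [h = 1 + z * tilt h] at a well chosen [z < 1] has mean at most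
   [4n], and it dominates the weighted sum of [z ^ m * tilt ^ m 1]. *)
Lemma tilt_growth (n : nat) : (0 < n)%N ->
  12 * theta ^+ 2 / ip_gap p mu <= 4^-1 ->
  \sum_(m < n.+1) mean mu (kpow tilt m) <=
  8 * n%:R * expR (24 * theta ^+ 2 / ip_gap p mu * n%:R).
Proof.
set eta := ip_gap p mu => n0 kle.
have eta0 : 0 < eta by have := theta_le; have := theta_gt0; rewrite -/eta; lra.
have nR : 0 < n%:R :> R by rewrite ltr0n.
have nV : n%:R^-1 <= 1 :> R by rewrite invf_le1// ler1n.
have nV0 : 0 < n%:R^-1 :> R by rewrite invr_gt0.
(* [eps = 2 theta^2 <= 4 theta^2 / eta], as [eta <= 2], and [2 delta^2 / eta = 8 theta^2 / eta]. *)
pose ka := 12 * theta ^+ 2 / eta.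
have ka0 : 0 <= ka by rewrite divr_ge0// ?mulr_ge0 ?sqr_ge0 ?ltW.
have kaE : 2 * theta ^+ 2 + 2 * (2 * theta) ^+ 2 / eta <= ka.
  rewrite /ka -(ler_pM2r eta0) mulrDl !divfK ?gt_eqF//.
  have : theta ^+ 2 * eta <= theta ^+ 2 * 2 by rewrite ler_wpM2l// sqr_ge0.
  by rewrite exprMn; lra.
(* The excess [1 / (4 n)] over [ka] is what remains as the coefficient of the mean, whence the bound
   [4 n]. *)
pose s := ka + 4^-1 * n%:R^-1; pose z := 1 - s.
have s0 : 0 <= s by rewrite addr_ge0// mulr_ge0// ltW.
have s1 : s <= 2^-1 by rewrite /s; move: kle; rewrite -/ka; lra.
have z0 : 0 <= z by rewrite /z; lra.
have t0 x y : 0 <= tilt x y by rewrite mulr_ge0// expR_ge0.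
have RB b y h : 0 <= y <= z -> (forall x, h x = b + y * kact tilt h x) ->
    4^-1 * n%:R^-1 * `|mean mu h| <= `|b| /\
    mean mu (fun x => h x ^+ 2) <= 2 * mean mu h ^+ 2.
  move=> /andP[y0 yz] hE.
  have [|||c1 c2] := resolvent_bound ptrans muinv mu_gt0 tilt_close
    tilt_mean_close _ eta0 _ _ hE.
  - by have := theta_gt0; lra.
  - by have := theta_le; lra.
  - by rewrite y0 /=; move: yz; rewrite /z; lra.
  split=> //; apply: le_trans c1; rewrite ler_wpM2r//.
  by move: yz kaE; rewrite /z /s -/eta; lra.
have meanB' h : (forall x, 0 <= h x) -> 4^-1 * n%:R^-1 * `|mean mu h| <= `|1| ->
    mean mu h <= 4 * n%:R.
  move=> h0; rewrite normr1 ger0_norm ?mean_ge0// mulrC.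
  by rewrite -invfM -ler_pdivlMr ?invr_gt0 ?mulr_gt0// invrK mul1r.
(* The pointwise bound sums [4 n / mu x] over all states; being only an a priori bound, it does not
   enter the final estimate. *)
have [||h [h0 hE hs]] := @neumann_bound _ _ tilt t0 z
  (\sum_x (mu x)^-1 * (4 * n%:R)) z0.
- move=> y h yz hE; apply/ffunP => x; rewrite ffunE.
  have [|c1 c2] := RB 0 y h yz; first by move=> x'; rewrite add0r.
  apply: (mean_sqr_eq0 muinv mu_gt0); apply: le_trans c2 _.
  move: c1; rewrite normr0 pmulr_rle0 ?mulr_gt0// normr_le0 => /eqP ->.
  by rewrite expr0n mulr0.
- move=> y h yz h0 hE x.
  have [c1 _] := RB 1 y h yz hE.
  have c := meanB' h h0 c1.
  rewrite (bigD1 x)//= -[X in X <= _]addr0 lerD//; last first.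
    by apply: sumr_ge0 => w _; rewrite !mulr_ge0// invr_ge0.
  rewrite mulrC ler_pdivlMr// mulrC; apply: le_trans c.
  rewrite /mean (bigD1 x)//= lerDl.
  by apply: sumr_ge0 => w _; rewrite mulr_ge0.
have hc : mean mu h <= 4 * n%:R.
  by apply: meanB' => //; have [] := RB 1 z h _ hE; rewrite ?z0 ?lexx.
have z1 : z <= 1 by rewrite /z; lra.
have a0 m : 0 <= mean mu (kpow tilt m).
  apply: mean_ge0 => //; elim: m => [|m IH] x /=; first exact: ler01.
  exact: mean_ge0.
have S1 : z ^+ n * \sum_(m < n.+1) mean mu (kpow tilt m) <= 4 * n%:R.
  apply: le_trans hc; apply: le_trans (le_mean mu_ge0 (hs n.+1)).
  rewrite mulr_sumr /mean; under [X in _ <= X]eq_bigr do rewrite mulr_sumr.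
  rewrite exchange_big; apply: ler_sum => m _ /=.
  under [X in _ <= X]eq_bigr do rewrite mulrCA.
  by rewrite -mulr_sumr ler_wpM2r ?a0// ler_wiXn2l// -ltnS.
(* For [s <= 1/2] one has [(1 - s) (1 + 2 s) >= 1]. *)
have zexp : expR (- (2 * s)) <= z.
  rewrite expRN -div1r ler_pdivrMr ?expR_gt0//.
  apply: (@le_trans _ _ (z * (1 + 2 * s))).
    have : 0 <= s * (1 - 2 * s) by rewrite mulr_ge0//; lra.
    by rewrite /z; lra.
  by rewrite ler_wpM2l// expR_ge1Dx.
have S2 : expR (- (2 * s * n%:R)) * \sum_(m < n.+1) mean mu (kpow tilt m) <= 4 * n%:R.
  apply: le_trans S1; rewrite ler_wpM2r ?sumr_ge0//.
  by rewrite -mulNr expRM_natr ler_pXn2r ?nnegrE// expR_ge0.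
(* The leftover factor [exp (1/2) <= 2] turns [4 n] into [8 n]. *)
have sE : 2 * s * n%:R = 24 * theta ^+ 2 / eta * n%:R + 2^-1.
  rewrite /s /ka; have : n%:R != 0 :> R by rewrite gt_eqF.
  by move=> ?; field; rewrite gt_eqF.
move: S2; rewrite sE opprD expRD !expRN; set e := expR (24 * _ / _ * _).
have e0 : 0 < e := expR_gt0 _.
have half : 2^-1 <= (expR (2^-1))^-1 :> R.
  by rewrite -expRN; have := expR_ge1Dx (- 2^-1 : R); lra.
rewrite -mulrA mulrC ler_pdivrMr// => S3.
have : 2^-1 * \sum_(m < n.+1) mean mu (kpow tilt m) <= 4 * n%:R * e.
  by apply: le_trans S3; rewrite ler_wpM2r// sumr_ge0.
by lra.
Qed.

End Tilt.

(** * Path expectations, splitting in time and the Chernoff bound *)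

Section Paths.
Context {R : realType} {Omega : finType}.
Variable p : Omega -> Omega -> R.
Hypothesis ptrans : is_transition p.
Implicit Types (phi psi : seq Omega -> R) (F : Omega -> Omega -> R).

Let p_ge0 x y : 0 <= p x y. Proof. exact: (ptrans x).1. Qed.

(* Expectation of [phi] at the [n] states that follow the initial state [x]. *)
Fixpoint path_mean (n : nat) (x : Omega) phi : R :=
  if n is m.+1 then
    mean (p x) (fun y => path_mean m y (fun s => phi (y :: s)))
  else phi [::].

Fixpoint path_sum F (x : Omega) (s : seq Omega) : R :=
  if s is y :: s' then F x y + path_sum F y s' else 0.

Lemma path_sum_cat F x s1 s2 :
  path_sum F x (s1 ++ s2) = path_sum F x s1 + path_sum F (last x s1) s2.
Proof.
by elim: s1 x => [|y s1 IH] x /=; rewrite ?add0r// IH addrA.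
Qed.

Lemma path_sumN F x s :
  path_sum (fun a b => - F a b) x s = - path_sum F x s.
Proof. by elim: s x => [|y s IH] x /=; rewrite ?oppr0// IH opprD. Qed.

Lemma path_sum_norm_le F x s : (forall a b, `|F a b| <= 1) ->
  `|path_sum F x s| <= (size s)%:R.
Proof.
move=> F1; elim: s x => [|y s IH] x /=; first by rewrite normr0.
by rewrite -natr1 addrC (le_trans (ler_normD _ _))// lerD.
Qed.

Lemma le_path_mean n x phi psi : (forall s, size s = n -> phi s <= psi s) ->
  path_mean n x phi <= path_mean n x psi.
Proof.
elim: n x phi psi => [|n IH] x phi psi le /=; first exact: le.
by apply: le_mean => // y; apply: IH => s sn; apply: le; rewrite /= sn.
Qed.

Lemma eq_path_mean n x phi psi : (forall s, size s = n -> phi s = psi s) ->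
  path_mean n x phi = path_mean n x psi.
Proof.
by move=> e; apply/eqP; rewrite eq_le !le_path_mean// => s sn; rewrite e.
Qed.

Lemma path_mean_cst n x c : path_mean n x (fun=> c) = c.
Proof.
elim: n x => [|n IH] x //=.
by rewrite (eq_mean (p x) (g := fun=> c)) ?mean_cst.
Qed.

Lemma path_mean_ge0 n x phi : (forall s, 0 <= phi s) -> 0 <= path_mean n x phi.
Proof.
by move=> phi0; rewrite -[leLHS](path_mean_cst n x 0); exact: le_path_mean.
Qed.

Lemma path_meanZ n x c phi :
  path_mean n x (fun s => c * phi s) = c * path_mean n x phi.
Proof.
elim: n x phi => [|n IH] x phi //=.
by rewrite -meanZ; apply: eq_mean => y; rewrite IH.
Qed.

Lemma path_meanD n x phi psi :
  path_mean n x (fun s => phi s + psi s) = path_mean n x phi + path_mean n x psi.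
Proof.
elim: n x phi psi => [|n IH] x phi psi //=.
by rewrite -meanD; apply: eq_mean => y; rewrite IH.
Qed.

Lemma path_mean_cat m n x phi : path_mean (m + n) x phi =
  path_mean m x (fun s1 => path_mean n (last x s1) (fun s2 => phi (s1 ++ s2))).
Proof.
elim: m x phi => [|m IH] x phi //.
by rewrite addSn /=; apply: eq_mean => y; rewrite IH.
Qed.

Lemma path_mean_tilt F theta n x :
  path_mean n x (fun s => expR (theta * path_sum F x s)) =
  kpow (tilt p F theta) n x.
Proof.
elim: n x => [|n IH] x /=; first by rewrite mulr0 expR0.
rewrite -[RHS]/(mean (tilt p F theta x) (kpow (tilt p F theta) n)).
apply: eq_bigr => y _; rewrite -IH /tilt -mulrA; congr (_ * _); rewrite -path_meanZ.
by apply: eq_path_mean => s _; rewrite mulrDr expRD.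
Qed.

(** [exp (theta (a + b) / 2)] is at most the average of [exp (theta a)] and [exp (theta b)]. Halving
    theta thus decouples the two dependent pieces of the path. *)
Lemma path_mean_half_le F theta m n x :
  path_mean (m + n) x (fun s => expR (theta / 2 * path_sum F x s)) <=
  2^-1 * (kpow (tilt p F theta) m x +
          path_mean m x (fun s => kpow (tilt p F theta) n (last x s))).
Proof.
rewrite path_mean_cat -path_mean_tilt -path_meanD -path_meanZ.
apply: le_path_mean => s1 _.
rewrite -(path_mean_cst n (last x s1) (expR (theta * path_sum F x s1))).
rewrite -path_mean_tilt -path_meanD -path_meanZ; apply: le_path_mean => s2 _.
rewrite path_sum_cat mulrDr expRD.
set a := path_sum F x s1; set b := path_sum F _ s2.
have half c : expR (theta * c) = expR (theta / 2 * c) ^+ 2.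
  by rewrite -expRM_natr; congr expR; field.
rewrite !half; have := sqr_ge0 (expR (theta / 2 * a) - expR (theta / 2 * b)).
by rewrite sqrrB; lra.
Qed.

(** Under stationarity the second piece of a split path again starts from [mu]. *)
Lemma mean_path_last (mu : Omega -> R) n f : invariant_dist p mu ->
  mean mu (fun x => path_mean n x (fun s => f (last x s))) = mean mu f.
Proof.
move=> muinv; elim: n => [|n IH] //=.
exact: (etrans (mean_inv muinv (fun y => path_mean n y (fun s => f (last y s))))).
Qed.

Lemma ratio_sup_ge (nu mu : Omega -> R) x : nu x / mu x <= ratio_sup nu mu.
Proof. exact: (le_bigmax 0 (fun x => nu x / mu x) x). Qed.

(** The change of initial law from [nu] to [mu], made once for a nonnegative function. *)
Lemma mean_ratio_le (nu mu : Omega -> R) f : (forall x, 0 < mu x) ->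
  (forall x, 0 <= f x) -> mean nu f <= ratio_sup nu mu * mean mu f.
Proof.
move=> mu0 f0; rewrite /mean mulr_sumr; apply: ler_sum => x _.
by rewrite mulrA ler_wpM2r// -ler_pdivrMr// ratio_sup_ge.
Qed.

Lemma ratio_sup_ge1 (nu mu : Omega -> R) : is_distribution nu ->
  is_distribution mu -> (forall x, 0 < mu x) -> 1 <= ratio_sup nu mu.
Proof.
move=> dnu dmu mu0.
have := @mean_ratio_le nu mu (fun=> 1) mu0 (fun=> ler01).
by rewrite !mean_cst// mulr1.
Qed.

Variables (mu nu : Omega -> R) (F : Omega -> Omega -> R) (theta : R).
Hypotheses (muinv : invariant_dist p mu) (mu_gt0 : forall x, 0 < mu x).
Hypothesis nudist : is_distribution nu.
Hypothesis F_le1 : forall x y, `|F x y| <= 1.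
Hypothesis F_mean0 : mean mu (fun x => mean (p x) (F x)) = 0.
Hypothesis theta_gt0 : 0 < theta.
Hypothesis theta_le : 4 * theta <= ip_gap p mu.
Hypothesis gap_le2 : ip_gap p mu <= 2.

(* [path_mean_half_le] bounds the left-hand side through every splitting time
   [m]; averaging over [m] only requires the growth of the tilted kernel on
   average over time, which is what [tilt_growth] provides. *)
Lemma path_mgf_le n : (0 < n)%N -> 12 * theta ^+ 2 / ip_gap p mu <= 4^-1 ->
  mean nu (fun x => path_mean n x (fun s => expR (theta / 2 * path_sum F x s)))
  <= 8 * ratio_sup nu mu * expR (24 * theta ^+ 2 / ip_gap p mu * n%:R).
Proof.
move=> n0 small; set L := mean nu _; set e := expR _.
set r := ratio_sup nu mu.
have r0 : 0 <= r by apply: le_trans (ratio_sup_ge1 nudist muinv.1 mu_gt0).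
pose a m := mean mu (kpow (tilt p F theta) m).
have k0 m x : 0 <= kpow (tilt p F theta) m x.
  by rewrite -path_mean_tilt path_mean_ge0// => s; exact: expR_ge0.
have split (m : 'I_n.+1) : L <= r * (2^-1 * (a m + a (rev_ord m))).
  apply: (@le_trans _ _ (mean nu (fun x => 2^-1 * (kpow (tilt p F theta) m x +
     path_mean m x (fun s => kpow (tilt p F theta) (rev_ord m) (last x s)))))).
    apply: le_mean => [|x]; first exact: nudist.1.
    apply: le_trans (path_mean_half_le _ _ _ _ _).
    by rewrite /= subSS subnKC// -ltnS.
  apply: le_trans (mean_ratio_le _ mu_gt0 _) _ => [x|].
    by rewrite mulr_ge0// addr_ge0// path_mean_ge0.
  by rewrite meanZ meanD mean_path_last.
have : \sum_(m < n.+1) L <= \sum_(m < n.+1) r * (2^-1 * (a m + a (rev_ord m))).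
  by apply: ler_sum => m _; exact: split.
rewrite sumr_const card_ord -mulr_sumr -mulr_sumr big_split /=.
(* [rev_ord m] is [n - m], so both pieces run over the same times and contribute equal sums. *)
have -> : \sum_(m < n.+1) a (n.+1 - m.+1)%N = \sum_(m < n.+1) a m.
  by rewrite [RHS](reindex_inj rev_ord_inj).
have := tilt_growth ptrans muinv mu_gt0 F_le1 F_mean0 theta_gt0 theta_le gap_le2 n0 small.
rewrite -/e => /(ler_wpM2l r0) G; rewrite -[L *+ _]mulr_natr => H.
have nR : 0 < n.+1%:R :> R by rewrite ltr0n.
rewrite -(ler_pM2r nR).
have e0 : 0 <= r * e by rewrite mulr_ge0// expR_ge0.
have : r * e * n%:R <= r * e * n.+1%:R by rewrite ler_wpM2l// ler_nat.
by move: H G; rewrite /a; lra.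
Qed.

(** Chernoff at the parameter [theta / 2], where the moment generating function is controlled: the
    indicator is at most [exp (theta / 2 * (S_n - n t))]. *)
Lemma path_tail_le n (t : R) : (0 < n)%N -> 12 * theta ^+ 2 / ip_gap p mu <= 4^-1 ->
  mean nu (fun x => path_mean n x (fun s => (n%:R * t <= path_sum F x s)%R%:R))
  <= 8 * ratio_sup nu mu *
     expR (24 * theta ^+ 2 / ip_gap p mu * n%:R - theta / 2 * (n%:R * t)).
Proof.
move=> n0 small; rewrite expRD mulrA.
apply: le_trans (ler_wpM2r (expR_ge0 _) (path_mgf_le n0 small)).
rewrite [leRHS]mulrC -meanZ; apply: le_mean => [|x]; first exact: nudist.1.
rewrite -path_meanZ; apply: le_path_mean => s _.
rewrite -expRD; case: (lerP (n%:R * t)) => [le|_]; last exact: expR_ge0.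
apply: (@le_trans _ _ (1 + (- (theta / 2 * (n%:R * t)) + theta / 2 * path_sum F x s))).
  by rewrite lerDl addrC subr_ge0 ler_wpM2l// divr_ge0// ltW.
exact: expR_ge1Dx.
Qed.

End Paths.

(** * The law of the chain as a path expectation *)

Section ChainLaw.
Context {R : realType} {d : measure_display} {T : measurableType d}.
Context {Omega : finType}.
Variables (Pr : probability T R) (p : Omega -> Omega -> R) (nu : Omega -> R).
Variable X : nat -> T -> Omega.
Hypotheses (ptrans : is_transition p) (chain : markov_chain Pr p nu X).

Let X_meas k (A : set Omega) : measurable [set w | A (X k w)].
Proof. by case: chain => mX _ _; exact: mX. Qed.

Lemma prob_partition k (E : set T) : measurable E ->
  Pr E = (\sum_y Pr (E `&` [set w | X k w = y]))%E.
Proof.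
move=> mE.
(* Induction over duplicate-free lists of states replaces a disjoint union over the whole type. *)
suff part s : uniq s -> Pr (E `&` [set w | X k w \in s]) =
    (\sum_(y <- s) Pr (E `&` [set w | X k w = y]))%E.
  rewrite -part ?index_enum_uniq//; congr (Pr _).
  by apply/seteqP; split=> [w Ew|w []//]; split=> //=; exact: mem_index_enum.
elim: s => [_|y s IH /= /andP[ys us]].
  rewrite big_nil (_ : _ `&` _ = set0) ?measure0//.
  by apply/seteqP; split=> // w [].
rewrite big_cons -IH// -measureU.
- congr (Pr _); rewrite -setIUr; congr (_ `&` _).
  apply/seteqP; split=> w /=; rewrite inE.
    by case/orP => [/eqP|]; [left|right].
  by case=> [->|->]; rewrite ?eqxx ?orbT.
- exact: measurableI (X_meas k [set y]).
- exact: measurableI (X_meas k [set` s]).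
- apply/seteqP; split=> // w [[_ /= Xy] [_ /=]].
  by rewrite Xy (negPf ys).
Qed.

Lemma path_event_measurable a n (Q : seq Omega -> bool) :
  measurable [set w | Q [seq X i w | i <- iota a n]].
Proof.
elim: n a Q => [|n IH] a Q /=.
  case: (Q [::]).
    by rewrite (_ : [set _ | _] = setT); [exact: measurableT|by apply/seteqP; split].
  by rewrite (_ : [set _ | _] = set0); [exact: measurable0|by apply/seteqP; split].
rewrite (_ : [set _ | _] = \bigcup_(y in [set: Omega])
  ([set w | X a w = y] `&`
   [set w | Q (y :: [seq X i w | i <- iota a.+1 n])])); last first.
  apply/seteqP; split=> [w Qw|w [y _ []] /= ->//].
  by exists (X a w).
apply: fin_bigcup_measurable => // y _; apply: measurableI.
  exact: (X_meas a [set y]).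
exact: (IH a.+1 (fun s => Q (y :: s))).
Qed.

Let history k (x : nat -> Omega) := [set w | forall i, (i <= k)%N -> X i w = x i].

Let history_meas k x : measurable (history k x).
Proof.
rewrite (_ : history k x = [set w |
    [seq X i w | i <- iota 0 k.+1] == [seq x i | i <- iota 0 k.+1]]).
  exact: (@path_event_measurable 0 k.+1
    (fun s => s == [seq x i | i <- iota 0 k.+1])).
apply/seteqP; split=> w.
  move=> H; apply/eqP/eq_in_map => i; rewrite mem_iota => /andP[_].
  by rewrite add0n ltnS; exact: H.
by move=> /eqP/eq_in_map H i ik; apply: H; rewrite mem_iota.
Qed.

(** The Markov property iterated over the next state; the product form with the past covers null
    histories as well. *)
Lemma history_path_prob k x n (Q : seq Omega -> bool) :
  Pr (history k x `&` [set w | Q [seq X i w | i <- iota k.+1 n]]) =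
  (Pr (history k x) * (path_mean p n (x k) (fun s => (Q s)%:R))%:E)%E.
Proof.
elim: n k x Q => [|n IH] k x Q /=.
  case: (Q [::]).
    by rewrite (_ : [set _ | _] = setT) ?setIT ?mule1//; by apply/seteqP; split.
  rewrite (_ : [set _ | _] = set0) ?setI0 ?measure0 ?mule0//.
  by apply/seteqP; split.
rewrite (prob_partition k.+1); last first.
  apply: measurableI => //; exact: (@path_event_measurable k.+1 n.+1 Q).
rewrite /mean -sumEFin ge0_sume_distrr; last first.
  move=> y _; rewrite lee_fin mulr_ge0 ?(ptrans _).1//.
  by rewrite (path_mean_ge0 ptrans)// => s; exact: ler0n.
apply: eq_bigr => y _.
(* The prescribed past, extended by [y] at time [k.+1], is a history to which induction applies. *)
pose x' i := if i == k.+1 then y else x i.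
have x'k i : (i <= k)%N -> x' i = x i.
  by move=> ik; rewrite /x' ltn_eqF.
have x'k1 : x' k.+1 = y by rewrite /x' eqxx.
have hist' : history k x' = history k x.
  by apply/seteqP; split=> w H i ik; rewrite H// x'k.
have -> : history k x `&` [set w | Q (X k.+1 w :: [seq X i w | i <- iota k.+2 n])]
     `&` [set w | X k.+1 w = y] =
   history k.+1 x' `&` [set w | Q (y :: [seq X i w | i <- iota k.+2 n])].
  apply/seteqP; split=> w /=.
    move=> [[H Qw] Xy]; split; last by rewrite -Xy.
    move=> i; rewrite leq_eqVlt => /orP[/eqP ->|ik]; first by rewrite Xy x'k1.
    by rewrite H// x'k.
  move=> [H Qw]; have Xy : X k.+1 w = y by rewrite H// x'k1.
  split=> //; split=> [i ik|]; last by rewrite Xy.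
  by rewrite H ?x'k// ltnW.
rewrite (IH k.+1 x' (fun s => Q (y :: s))) x'k1.
have [_ _ ->] := chain.
by rewrite -/(history k x') hist' x'k1 x'k// EFinM muleA.
Qed.

Lemma path_prob n (Q : Omega -> seq Omega -> bool) :
  Pr [set w | Q (X 0 w) [seq X i w | i <- iota 1 n]] =
  (mean nu (fun x => path_mean p n x (fun s => (Q x s)%:R)))%:E.
Proof.
rewrite (prob_partition 0); last first.
  (* The list has [n.+1] states, so the value on the empty list never matters. *)
  apply: (@path_event_measurable 0 n.+1
    (fun s => if s is y :: s' then Q y s' else true)).
rewrite /mean -sumEFin; apply: eq_bigr => x _.
have [_ init _] := chain.
have hist0 : history 0 (fun=> x) = [set w | X 0 w = x].
  by apply/seteqP; split=> [w /(_ 0 (leqnn _))|w H [|i]].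
rewrite EFinM -init -hist0.
rewrite -(@history_path_prob 0 (fun=> x) n (Q x)); congr (Pr _).
rewrite hist0; apply/seteqP; split=> w /= [].
  by move=> Qw Xx; rewrite -Xx.
by move=> Xx Qw; rewrite Xx.
Qed.

Lemma path_sum_traj (F : Omega -> Omega -> R) n a w :
  path_sum F (X a w) [seq X i w | i <- iota a.+1 n] =
  \sum_(i < n) F (X (a + i)%N w) (X (a + i).+1 w).
Proof.
elim: n a => [|n IH] a /=; first by rewrite big_ord0.
rewrite big_ord_recl IH addn0; congr (_ + _); apply: eq_bigr => i _.
by rewrite /= addnS.
Qed.

End ChainLaw.

(** * Choice of the tilt and the two-sided deviation bound *)

Theorem theorem1p1 (R : realType) :
  exists C1 C2 : R, [/\ 0 < C1, 0 < C2 &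
    forall (Omega : finType) (p : Omega -> Omega -> R) (mu nu : Omega -> R)
      (d : measure_display) (T : measurableType d) (Pr : probability T R)
      (X : nat -> T -> Omega),
      (1 < #|Omega|)%N ->
      is_transition p ->
      irreducible p ->
      invariant_dist p mu ->
      is_distribution nu ->
      markov_chain Pr p nu X ->
      forall (n : nat) (t : R) (u v : Omega),
        (0 < n)%N -> 0 < t ->
        (Pr [set w | (t <= `|pair_freq R X n u v w - mu u * p u v|)%R] <=
         (C1 * ratio_sup nu mu * expR (- (C2 * ip_gap p mu * n%:R * t ^+ 2)))%:E)%E].
Proof.
(* Two tails with factor 8 each; [1/384 = 1/192 - 24/96^2] comes from [theta = eta t / 96]. *)
exists 16, 384^-1; split; [by rewrite ltr0n|by rewrite invr_gt0 ltr0n|].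
move=> Omega p mu nu d T Pr X O1 ptrans irr muinv nudist chain
  n t u v n0 t0.
have mu_gt0 := inv_pos ptrans muinv irr.
have gap2 := ip_gap_le2 ptrans muinv mu_gt0 O1.
have r1 := ratio_sup_ge1 nudist muinv.1 mu_gt0.
set eta := ip_gap p mu in gap2 *; set r := ratio_sup nu mu in r1 *.
set q := mu u * p u v.
pose F x y : R := ((x, y) == (u, v))%:R - q.
pose Q x s := (n%:R * t <= `|path_sum F x s|).
have nR : 0 < n%:R :> R by rewrite ltr0n.
have -> : [set w | t <= `|pair_freq R X n u v w - q|] =
          [set w | Q (X 0%N w) [seq X i w | i <- iota 1 n]].
  apply/seteqP; suff E w : (t <= `|pair_freq R X n u v w - q|) =
    Q (X 0%N w) [seq X i w | i <- iota 1 n] by split=> w /=; rewrite E.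
  rewrite /Q.
  have -> : path_sum F (X 0%N w) [seq X i w | i <- iota 1 n] =
            n%:R * (pair_freq R X n u v w - q).
    rewrite path_sum_traj sumrB sumr_const card_ord -[q *+ n]mulr_natl.
    by rewrite /pair_freq mulrBr mulVKf// gt_eqF.
  by rewrite normrM (ger0_norm (ltW nR)) ler_pM2l.
rewrite (path_prob ptrans chain n Q) lee_fin.
have dist_le1 (f : Omega -> R) x : is_distribution f -> f x <= 1.
  move=> [f0 <-]; rewrite (bigD1 x)//= lerDl; exact: sumr_ge0.
have q01 : 0 <= q <= 1.
  have m1 := dist_le1 _ u muinv.1; have p1 := dist_le1 _ v (ptrans u).
  rewrite mulr_ge0 ?mulr_ile1//; [exact: muinv.1.1|exact: (ptrans u).1|
    exact: muinv.1.1|exact: (ptrans u).1].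
have F1 x y : `|F x y| <= 1.
  by case/andP: q01 => q0 q1; rewrite /F; case: (_ == _); rewrite /= ler_norml; lra.
have Fmean : mean mu (fun x => mean (p x) (F x)) = 0.
  have -> : mean mu (fun x => mean (p x) (F x)) =
            mean mu (fun x => mean (p x) (fun y => ((x, y) == (u, v))%:R) - q).
    by apply: eq_mean => x; rewrite /F meanB mean_cst.
  rewrite meanB (mean_cst _ muinv.1) /q -(mean_indic mu u) -[X in _ - X]mulrC.
  rewrite -meanZ; apply/eqP; rewrite subr_eq0; apply/eqP/eq_mean => x.
  have [->|xu] := eqVneq x u.
    rewrite mulr1 -(mean_indic (p u) v); apply: eq_mean => y.
    by rewrite xpair_eqE eqxx.
  rewrite mulr0 /mean big1// => y _.
  by rewrite xpair_eqE (negPf xu) mulr0.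
(* For [t > 1] the event is empty, as [|S_n| <= n]. *)
have [t1|t1] := ltP 1 t.
  apply: (@le_trans _ _ 0); last by rewrite !mulr_ge0 ?expR_ge0 ?(le_trans _ r1).
  rewrite -[leRHS](mean_cst 0 nudist); apply: le_mean => [|x]; first exact: nudist.1.
  rewrite -[leRHS](path_mean_cst ptrans n x 0); apply: le_path_mean => // s sn.
  rewrite (_ : Q x s = false)//; apply/negbTE; rewrite -ltNge.
  by rewrite (le_lt_trans (path_sum_norm_le _ _ F1))// sn ltr_pMr.
(* With zero gap the right-hand side is at least 16, since the ratio is at least 1. *)
have [eta0|eta0] := ltP 0 eta; last first.
  apply: (@le_trans _ _ 1).
    rewrite -[leRHS](mean_cst 1 nudist); apply: le_mean => [|x]; first exact: nudist.1.
    rewrite -[leRHS](path_mean_cst ptrans n x 1); apply: le_path_mean => // s _.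
    by rewrite lern1 leq_b1.
  have -> : eta = 0 by apply/eqP; rewrite eq_le eta0 ip_gap_ge0.
  by rewrite mulr0 !mul0r oppr0 expR0 mulr1; lra.
(* The minimiser of [24 theta^2 / eta - theta t / 2]; [t <= 1] and [eta <= 2] make it small
   enough. *)
pose theta := eta * t / 96.
have et : eta * t <= eta by rewrite ger_pMr.
have et0 : 0 < eta * t by rewrite mulr_gt0.
have theta0 : 0 < theta by rewrite divr_gt0.
have theta4 : 4 * theta <= eta by rewrite /theta; lra.
have tt : t ^+ 2 <= 1 by rewrite expr_le1// ltW.
have small : 12 * theta ^+ 2 / eta <= 4^-1.
  have -> : 12 * theta ^+ 2 / eta = (eta * t ^+ 2) / 768.
    by rewrite /theta; field; rewrite gt_eqF.
  have : eta * t ^+ 2 <= eta * 1 by rewrite ler_wpM2l// ltW.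
  by lra.
have tail G : (forall x y, `|G x y| <= 1) ->
    mean mu (fun x => mean (p x) (G x)) = 0 ->
    mean nu (fun x => path_mean p n x
      (fun s => (n%:R * t <= path_sum G x s)%R%:R)) <=
    8 * r * expR (- (384^-1 * eta * n%:R * t ^+ 2)).
  move=> G1 Gmean.
  apply: le_trans (path_tail_le ptrans muinv mu_gt0 nudist G1 Gmean theta0
    theta4 gap2 t n0 small) _.
  rewrite -/r -/eta le_eqVlt; apply/orP; left; apply/eqP.
  by congr (_ * expR _); rewrite /theta; field; rewrite gt_eqF.
(* The lower tail of [F] is the upper tail of [- F]. *)
have NF1 x y : `|- F x y| <= 1 by rewrite normrN.
have NFmean : mean mu (fun x => mean (p x) (fun y => - F x y)) = 0.
  rewrite -[RHS]oppr0 -Fmean -mulN1r -meanZ; apply: eq_mean => x.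
  by rewrite -meanZ; apply: eq_mean => y; rewrite mulN1r.
apply: le_trans (_ : _ <= _ + _) _; last first.
  have := tail _ F1 Fmean; have := tail _ NF1 NFmean.
  move=> A B; have := lerD B A; move=> /le_trans; apply.
  by rewrite -mulrDl -mulrDl; lra.
rewrite -meanD; apply: le_mean => [|x]; first exact: nudist.1.
rewrite -(path_meanD p); apply: le_path_mean => // s _.
rewrite path_sumN /Q.
by rewrite ler_normr; do 2 case: lerP => _; rewrite /= ?addr0 ?add0r ?lerDl.
Qed.
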